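(* Let $(X,\mathscr{A},\mu)$ be a probability space, let $N\ge 1$ be an integer, and let $\mathscr{M}$ be a countable nonempty subset of $\mathscr{A}$. Let $$\mathscr{C}=\{(X_{1},\dots,X_{N})\in X^{N} : \{X_{1},\dots,X_{N}\} \text{ is an } (\mathscr{M},\mu)\text{-uniform point set}\}.$$ Then for every $f\in\mathscr{L}_{\infty}(X,\mathscr{A},\mu)$, $$\operatorname{esssup}_{(X_{1},\dots,X_{N})\in\mathscr{C}}\Big|\frac{1}{N}\sum_{n=1}^{N}f(X_{n})-\int_{X}f\, d\mu\Big|\leq 2D(f,L_{\mathscr{M}}).$$
   Context: $\mathscr{L}_{\infty}(X,\mathscr{A},\mu)$ is the space of essentially bounded $\mathscr{A}$-measurable real functions on $X$ (functions differing on a $\mu$-null set identified), with $\|g\|_\infty$ the essential supremum of $|g|$. For a nonempty $\mathscr{M}\subseteq\mathscr{A}$, $L_{\mathscr{M}}$ is the linear subspace of $\mathscr{L}_{\infty}(X,\mathscr{A},\mu)$ spanned by the constant function $1$ and the characteristic functions $\chi_M$, $M\in\mathscr{M}$, and $D(f,L_{\mathscr{M}})=\inf_{l\in L_{\mathscr{M}}}\|f-l\|_\infty$. A point set $\mathscr{P}=\{X_1,\dots,X_N\}$ of $N$ elements of $X$ (points counted with multiplicity) is called $(\mathscr{M},\mu)$-uniform if $\sum_{n=1}^{N}\chi_M(X_n)=\mu(M)N$ for all $M\in\mathscr{M}$. $X^N$ carries the product $\sigma$-algebra $\mathscr{A}\times\cdots\times\mathscr{A}$ and product measure $\mu^N=\mu\times\cdots\times\mu$;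 for countable $\mathscr{M}$ the set $\mathscr{C}$ is measurable. For a measurable function $h$ on $X^N$, $\operatorname{esssup}_{x\in\mathscr{C}}|h(x)|$ denotes the essential supremum of $|h|$ on $\mathscr{C}$ with respect to $\mu^N$, i.e. $\inf\{c : \mu^N(\{x\in\mathscr{C}: |h(x)|>c\})=0\}$. *)

(* Defs.v *)
From HB Require Import structures.
From mathcomp Require Import all_boot all_order all_algebra.
From mathcomp Require Import all_classical all_reals all_analysis.

Set Implicit Arguments.
Unset Strict Implicit.
Unset Printing Implicit Defensive.

Import Order.TTheory GRing.Theory Num.Theory.
Import numFieldNormedType.Exports.

Local Open Scope classical_set_scope.
Local Open Scope ring_scope.

Section product_power.
Context (R : realType) (d : measure_display) (X : measurableType d).

Definition cons_pair (n : nat) (p : X * n.-tuple X) : n.+1.-tuple X :=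
  [tuple of p.1 :: p.2].

Lemma measurable_cons_pair (n : nat) : measurable_fun setT (@cons_pair n).
Proof. exact: measurable_cons. Qed.

HB.instance Definition _ (n : nat) :=
  isMeasurableFun.Build _ _ _ _ (@cons_pair n) (@measurable_cons_pair n).

Context (mu : probability X R).

(* The product measure mu^n on X^n, where [n.-tuple X] carries the product
   sigma-algebra: mu^0 is the unique probability on the one-point space X^0
   and mu^(n+1) is mu \x mu^n transported along (x, t) |-> x :: t. *)
Fixpoint power_measure (n : nat) : probability (n.-tuple X) R :=
  match n with
  | 0 => \d_([tuple] : 0.-tuple X)
  | m.+1 => distribution (mu \x power_measure m)%E (@cons_pair m)
  end.

Lemma power_measure_box (n : nat) (A : 'I_n -> set X) :
    (forall i, measurable (A i)) ->
  power_measure n [set x | forall i, A i (tnth x i)]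
    = (\prod_(i < n) mu (A i))%E.
Proof.
elim: n A => [|n IH] A mA /=.
  by rewrite big_ord0 diracE mem_set//= => -[].
rewrite big_ord_recl -IH//; rewrite /distribution /pushforward/=.
rewrite -product_measure1E//; last first.
  rewrite (_ : mkset _ = \bigcap_i [set x | A (lift ord0 i) (tnth x i)]);
    last by apply/seteqP; split=> x /= Ax i; [move=> _; exact: Ax|exact: Ax].
  apply: fin_bigcap_measurable => // i _; rewrite -[X in measurable X]setTI.
  exact: measurable_tnth.
congr (_ _); apply/seteqP; split => -[x t] /=.
  move=> Axt; split; first by have := Axt ord0; rewrite tnth0.
  by move=> i; have := Axt (lift ord0 i); rewrite tnthS.
move=> [/= Ax At] i; have [j ->|->] := unliftP ord0 i.
  by rewrite tnthS; exact: At.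
by rewrite tnth0.
Qed.

End product_power.

(* Point sets are counted with multiplicity, hence represented by tuples. *)
Definition uniform_point_set (R : realType) (d : measure_display)
    (X : measurableType d) (mu : probability X R) (M : set (set X)) (N : nat)
    (x : N.-tuple X) : Prop :=
  forall A, M A -> ((\sum_(n < N) \1_A (tnth x n))%:E = mu A * N%:R%:E)%E.

Definition linear_span (R : nzRingType) (V : lmodType R) (G : set V) : set V :=
  [set v | exists (k : nat) (c : 'I_k -> R) (g : 'I_k -> V),
     (forall i, G (g i)) /\ v = \sum_(i < k) c i *: g i].

(* Elements of L_oo are given by representatives: [f \in Lfun mu +oo]. *)
Definition indic_span (R : realType) (X : Type) (M : set (set X)) :
    set (X -> R) :=
  linear_span (cst 1 |` [set \1_A | A in M]).

Definition Linfty_dist (R : realType) (d : measure_display)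
    (X : measurableType d) (mu : probability X R)
    (f : X -> R) (L : set (X -> R)) : \bar R :=
  ereal_inf [set 'N[mu]_+oo[EFin \o (f \- l)%R]%E | l in L].

(* The bound c ranges over all reals, so this is -oo when C is a null set. *)
Definition esssup_on (R : realType) (d : measure_display)
    (T : measurableType d) (P : {measure set T -> \bar R}) (C : set T)
    (h : T -> R) : \bar R :=
  ereal_inf [set c%:E | c in [set c : R |
    P [set x | C x /\ c < `|h x|] = 0%E]].

(* Main.v *)
Require Import Defs.
From mathcomp Require Import all_boot all_order all_algebra.
From mathcomp Require Import all_classical all_reals all_analysis.
From mathcomp Require Import measurable_realfun ess_sup_inf.
Import Order.TTheory GRing.Theory Num.Theory.
Import numFieldNormedType.Exports.
Local Open Scope classical_set_scope.
Local Open Scope ring_scope.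

Set Implicit Arguments.
Unset Strict Implicit.

(** For [l] in the span of [1] and the indicators of [M], every uniform point
    set integrates [l] exactly. Hence the quadrature error of [f] equals that
    of [f - l], and is at most twice the essential supremum of [|f - l|] as
    soon as no point lies in the exceptional null set; almost all tuples have
    that property. It remains to take the infimum over [l]. *)

(** For one coordinate, the bad tuples lie in a box with one null side and all other sides equal to
    [setT], so its measure is a product with a zero factor. There are only finitely many
    coordinates. *)
Lemma power_measure_ae_tnth (R : realType) (d : measure_display)
    (X : measurableType d) (mu : probability X R) (N : nat) (P : set X) :
  (\forall y \ae mu, P y) ->
  \forall x \ae power_measure mu N, forall n, P (tnth x n).
Proof.
move=> [A [mA muA0 PA]]; apply: filter_forall => n.
pose B (i : 'I_N) := if i == n then A else setT.
have mB i : measurable (B i) by rewrite /B; case: ifP.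
exists (@tnth N X ^~ n @^-1` A); split.
- by rewrite -[X in measurable X]setTI; exact: measurable_tnth.
- rewrite (_ : _ @^-1` _ = [set x | forall i, B i (tnth x i)]); last first.
    apply/seteqP; split=> x /= Ax; last by have := Ax n; rewrite /B eqxx.
    by move=> i; rewrite /B; case: eqP => [->|].
  by rewrite power_measure_box// (bigD1 n)//= /B eqxx [mu A]muA0 mul0e.
- by move=> x /= Px; exact: PA.
Qed.

Lemma measurable_sum_tnth (R : realType) (d : measure_display)
    (X : measurableType d) (N : nat) (f : X -> R) :
  measurable_fun setT f ->
  measurable_fun setT (fun x : N.-tuple X => \sum_(n < N) f (tnth x n)).
Proof.
move=> mf; apply: measurable_sum => n.
exact: measurableT_comp mf (measurable_tnth n).
Qed.

(** Each set of [M] imposes one level-set condition on a measurable counting function, and there are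
    countably many such conditions. *)
Lemma measurable_uniform_point_set (R : realType) (d : measure_display)
    (X : measurableType d) (mu : probability X R) (N : nat)
    (M : set (set X)) :
  M `<=` measurable -> countable M ->
  measurable [set x : N.-tuple X | uniform_point_set mu M x].
Proof.
move=> mM /countable_injP[g ginj].
pose S (A : set X) := [set x : N.-tuple X |
  ((\sum_(n < N) \1_A (tnth x n) : R)%:E = mu A * N%:R%:E)%E].
have mS A : measurable A -> measurable (S A).
  move=> mA; have -> : S A = (fun x : N.-tuple X =>
      \sum_(n < N) \1_A (tnth x n)) @^-1` [set fine (mu A) * N%:R].
    apply/seteqP; split=> x /=; rewrite /S/= -[mu A]fineK ?fin_num_measure//.
      by rewrite -EFinM => -[].
    by rewrite -EFinM => ->.
  rewrite -[X in measurable X]setTI.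
  apply: measurable_sum_tnth => //; exact: measurable_indic.
(* The intersection over [M] is indexed by the codes [k]. As [g] is injective on [M], each inner
   intersection is a single [S A], or the whole space if [k] codes no set. *)
rewrite (_ : mkset _ = \bigcap_k
    \bigcap_(A in [set A | M A /\ g A = k]) S A); last first.
  apply/seteqP; split=> x /=; first by move=> xM k _ A [MA _]; exact: xM.
  by move=> xS A MA; exact: (xS (g A) Logic.I A (conj MA erefl)).
apply: bigcapT_measurable => k.
have [/set0P[A [MA gA]]|] := boolP ([set A | M A /\ g A = k] != set0).
  rewrite (_ : \bigcap_(_ in _) _ = S A); first exact: mS (mM _ MA).
  apply/seteqP; split=> x /=; first by apply.
  by move=> xA B [MB gB]; rewrite (ginj B A) ?inE ?gA.
by rewrite negbK => /eqP ->; rewrite bigcap_set0.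
Qed.

Lemma indic_generator_integrable (R : realType) (d : measure_display)
    (X : measurableType d) (mu : probability X R) (M : set (set X))
    (g : X -> R) :
  M `<=` measurable -> (cst 1 |` [set \1_A | A in M]) g ->
  mu.-integrable setT (EFin \o g).
Proof.
move=> mM [->|[A /mM mA <-]]; last exact: integrable_indic.
by apply/Lfun1_integrable; exact: Lfun_cst.
Qed.

Lemma indic_span_integrable (R : realType) (d : measure_display)
    (X : measurableType d) (mu : probability X R) (M : set (set X))
    (l : X -> R) :
  M `<=` measurable -> indic_span M l -> mu.-integrable setT (EFin \o l).
Proof.
move=> mM [k [c [g [gM ->]]]]; apply/Lfun1_integrable.
apply: rpred_sum => i _; apply: rpredZ.
by apply/Lfun1_integrable; exact: indic_generator_integrable mM (gM i).
Qed.

(** Both sides are linear in [l], so generators suffice: the constant 1 is immediate, and for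
    indicators the claim is uniformity itself. *)
Lemma uniform_point_set_exact (R : realType) (d : measure_display)
    (X : measurableType d) (mu : probability X R) (N : nat) (M : set (set X))
    (x : N.-tuple X) (l : X -> R) :
  (0 < N)%N -> M `<=` measurable -> uniform_point_set mu M x ->
  indic_span M l ->
  N%:R^-1 * \sum_(n < N) l (tnth x n) = \int[mu]_y l y.
Proof.
move=> N0 mM xM [k [c [g [gM ->]]]].
have NR : (N%:R : R) != 0 by rewrite pnatr_eq0 -lt0n.
have ig i := indic_generator_integrable mu mM (gM i).
have exg i : \sum_(n < N) g i (tnth x n) = N%:R * \int[mu]_y g i y.
  case: (gM i) => [->|[A MA <-]].
    have -> : \int[mu]_y (cst 1 : X -> R) y = 1.
      by rewrite Rintegral_cst// [X in fine X]probability_setT mulr1.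
    by rewrite mulr1 sumr_const card_ord.
  apply: EFin_inj; rewrite (xM _ MA) EFinM /Rintegral integral_indic//;
    last exact: mM.
  by rewrite setIT fineK ?fin_num_measure// 1?muleC//; exact: mM.
have -> : \int[mu]_y (\sum_(i < k) c i *: g i) y =
    \sum_(i < k) c i * \int[mu]_y g i y.
  rewrite /Rintegral.
  under eq_integral do rewrite fct_sumE -sumEFin.
  rewrite integral_sum//=; last first.
    by move=> i; exact: (integrableZl measurableT (c i) (ig i)).
  under eq_bigr => i _ do rewrite (integralZl measurableT (ig i)).
  rewrite -sum_fine; last first.
    by move=> i _; rewrite fin_numM// integrable_fin_num.
  by apply: eq_bigr => i _; rewrite fineM// integrable_fin_num.
under eq_bigr do rewrite fct_sumE.
rewrite exchange_big/= mulr_sumr; apply: eq_bigr => i _.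
by rewrite -mulr_sumr exg mulrCA mulKf.
Qed.

Lemma normr_Rintegral_le_ae (R : realType) (d : measure_display)
    (X : measurableType d) (mu : probability X R) (g : X -> R) (e : R) :
  0 <= e -> mu.-integrable setT (EFin \o g) ->
  (\forall y \ae mu, `|g y| <= e) -> `|\int[mu]_y g y| <= e.
Proof.
move=> e0 ig ge; apply: (le_trans (le_normr_Rintegral measurableT ig)).
have ing := integrable_abse ig.
rewrite -lee_fin /Rintegral fineK; last exact: integrable_fin_num ing.
rewrite -[leRHS]mule1 -(probability_setT mu) -integral_cst//.
apply: ae_ge0_le_integral => //.
- exact: (measurable_int mu ing).
- by apply: filterS ge => y gy _; rewrite lee_fin.
Qed.

Lemma ae_le_Lnorm_pinfty (R : realType) (d : measure_display)
    (X : measurableType d) (mu : probability X R) (g : X -> R) :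
  \forall y \ae mu, (`|g y|%:E <= 'N[mu]_+oo[EFin \o g])%E.
Proof.
(* The norm at [+oo] is the essential supremum only when the total mass is positive; here it is
   1. *)
rewrite unlock [X in (0 < X)%E]probability_setT lte01.
exact: (ess_sup_ge mu (abse \o (EFin \o g))).
Qed.

(** The factor 2 comes from the triangle inequality: one [e] bounds the average of [f - l] over the
    points, the other its integral. *)
Lemma uniform_point_set_error (R : realType) (d : measure_display)
    (X : measurableType d) (mu : probability X R) (N : nat) (M : set (set X))
    (x : N.-tuple X) (f l : X -> R) (e : R) :
  (0 < N)%N -> M `<=` measurable -> uniform_point_set mu M x ->
  mu.-integrable setT (EFin \o f) -> indic_span M l ->
  (\forall y \ae mu, `|f y - l y| <= e) ->
  (forall n, `|f (tnth x n) - l (tnth x n)| <= e) ->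
  `|N%:R^-1 * \sum_(n < N) f (tnth x n) - \int[mu]_y f y| <= 2 * e.
Proof.
move=> N0 mM xM intf lM ae_e x_e.
have e0 : 0 <= e by apply: le_trans (x_e (Ordinal N0)); exact: normr_ge0.
have intl := indic_span_integrable mu mM lM.
have intfl : mu.-integrable setT (EFin \o (f \- l)).
  exact: (integrableB measurableT intf intl).
(* Exactness on [l] makes the two subtracted terms cancel. *)
have -> : N%:R^-1 * \sum_(n < N) f (tnth x n) - \int[mu]_y f y =
    N%:R^-1 * \sum_(n < N) (f (tnth x n) - l (tnth x n)) -
    \int[mu]_y (f y - l y).
  rewrite RintegralB// sumrB mulrBr (uniform_point_set_exact N0 mM xM lM).
  by rewrite opprB addrA subrK.
rewrite (le_trans (ler_normB _ _))// mulr_natl mulr2n lerD//.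
  rewrite normrM ger0_norm ?invr_ge0// ler_pdivrMl ?ltr0n//.
  rewrite (le_trans (ler_norm_sum _ _ _))//.
  rewrite (le_trans (ler_sum _ (fun n _ => x_e n)))//.
  by rewrite sumr_const card_ord mulr_natl.
exact: normr_Rintegral_le_ae.
Qed.

Unset Implicit Arguments.
Set Strict Implicit.

Theorem theorem2p2 (R : realType) (d : measure_display) (X : measurableType d)
    (mu : probability X R) (N : nat) (N_ge1 : (1 <= N)%N)
    (M : set (set X)) (M_measurable : M `<=` measurable)
    (M_countable : countable M) (M_nonempty : M !=set0)
    (f : X -> R) (f_Linfty : f \in Lfun mu +oo%E) :
  (esssup_on (power_measure mu N)
     [set x : N.-tuple X | uniform_point_set mu M x]
     (fun x : N.-tuple X =>
        (N%:R^-1 * \sum_(n < N) f (tnth x n) - \int[mu]_y f y)%R)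
   <= 2%:E * Linfty_dist mu f (indic_span M))%E.
Proof.
have mf : measurable_fun setT f by move/sub_Lfun_mfun: f_Linfty; rewrite inE.
(* On a finite measure space, essentially bounded functions are integrable. *)
have intf : mu.-integrable setT (EFin \o f).
  apply/Lfun1_integrable; move: f_Linfty; apply: Lfun_subset;
    by rewrite ?leey ?fin_num_measure.
set h := (h in esssup_on _ _ h).
have mh : measurable_fun setT h.
  apply: measurable_funB => //.
  by apply: measurable_funM => //; exact: measurable_sum_tnth.
(* Moving the factor 2 to the left exposes the infimum, so a bound for each single [l] suffices. *)
rewrite -lee_pdivrMl//; apply: le_ereal_inf_tmp => _ [l lM <-].
rewrite lee_pdivrMl//.
have := ae_le_Lnorm_pinfty mu (f \- l).
have := Lnorm_ge0 mu +oo (EFin \o (f \- l)).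
case: ('N[mu]_+oo[_])%E => [e _ ae_e| _ _|//]; last first.
  by rewrite gt0_muley ?lte_fin ?leey.
(* For a finite norm [e], it remains to see that uniform tuples with error above [2 * e] form a null
   set. *)
rewrite -EFinM; apply: ereal_inf_lbound; exists (2 * e) => //=.
apply/negligibleP.
  apply: measurableI; first exact: measurable_uniform_point_set.
  rewrite -[X in measurable X]setTI.
  have mnh : measurable_fun setT (fun x => 2 * e < `|h x|).
    by apply: measurable_fun_ltr => //; exact: measurableT_comp.
  exact: (mnh measurableT [set true]).
(* By contraposition: a uniform tuple whose points all satisfy the bound [e] on [f - l] has error at
   most [2 * e]. *)
apply: negligibleS (power_measure_ae_tnth N ae_e) => x /= [xM + xe].
rewrite ltNge => /negP; apply.
by apply: (uniform_point_set_error N_ge1 M_measurable xM intf lM).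
Qed.
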